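(* Let $\phi$ be a proposition. Then $\phi$ is true if and only if $\phi$ has a combinatorial proof, i.e. there exist a nicely coloured cograph $C$ and a skew fibration $h:C\to G(\phi)$ such that every colour class of $C$ is axiomatic.
   Context: Propositions are expressions generated freely from a fixed set $\mathcal{V}$ of variables by binary $\wedge,\vee,\Rightarrow$, unary $\neg$, and constants $1$ (true), $0$ (false). A valuation is $f:\mathcal{V}\to\{0,1\}$, extended to $\hat f$ by $\hat f(0)=0$, $\hat f(1)=1$, $\hat f(\neg\phi)=1-\hat f(\phi)$, $\hat f(\phi\wedge\rho)=\min$, $\hat f(\phi\vee\rho)=\max$, $\hat f(\phi\Rightarrow\rho)=\hat f((\neg\phi)\vee\rho)$. A proposition is true if $\hat f(\phi)=1$ for all valuations $f$. Literals are variables $p$ and their negations $\overline p=\neg p$; $p$ and $\overline p$ are dual, as are $0$ and $1$. Atoms are literals and constants; $\mathcal{A}$ is the set of atoms. A graph $(V,E)$ is a finite set $V$ with a set $E$ of two-element subsets (edges) of $V$; write $vw$ for $\{v,w\}$. A homomorphism $h:G\to G'$ is a function $V(G)\to V(G')$ with $vw\in E(G)\Rightarrow h(v)h(w)\in E(G')$. For graphs with disjoint vertex sets, the union $G\vee G'$ is $(V\cup V',E\cup E')$ and the join $G\wedge G'$ adds all edges $vv'$ with $v\in V$, $v'\in V'$ (colourings/labellings inherited). An $\mathcal{A}$-labelled graph has an atom (label) attached to each vertex. For an $\mathcal{A}$-labelled graph $G$, $\neg G$ is obtained by complementing the edge set and replacing each label by its dual; $G\Rightarrow G' := (\neg G)\vee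 G'$. The graph $G(\phi)$ is defined by identifying each atom occurrence with a single vertex carrying that label and interpreting $\neg,\vee,\wedge,\Rightarrow$ as these graph operations (distinct occurrences giving distinct vertices). A coloured graph is a graph with an equivalence relation $\sim$ on $V$ such that $v\sim w$ (for $v\neq w$) implies $vw\notin E$; classes are colour classes. A set $W\subseteq V$ induces a matching if $W\neq\emptyset$ and each $w\in W$ has a unique $w'\in W$ with $ww'\in E$. A colouring is nice if every colour class has at most two vertices and no union of two-vertex colour classes induces a matching. A cograph is a graph with nonempty vertex set such that for any distinct $v,w,x,y$, the set of edges among $\{v,w,x,y\}$ is not exactly $\{vw,wx,xy\}$. A homomorphism $h:G\to G'$ is a skew fibration if for all $v\in V(G)$ and all $w$ with $h(v)w\in E(G')$ there is $\hat w$ with $v\hat w\in E(G)$ and $h(\hat w)w\notin E(G')$. For a homomorphism $h:C\to G'$ into an $\mathcal{A}$-labelled graph, a colour class $\{v\}$ is axiomatic if $h(v)$ is labelled $1$, and a colour class $\{v,w\}$ is axiomatic if $h(v),h(w)$ are labelled by dual literals. *)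

(* Defs.v *)
From mathcomp Require Import all_boot.

Set Implicit Arguments.
Unset Strict Implicit.
Unset Printing Implicit Defensive.

Inductive proposition (V : Type) : Type :=
  | PVar of V
  | PTrue
  | PFalse
  | PNot of proposition V
  | PAnd of proposition V & proposition V
  | POr of proposition V & proposition V
  | PImp of proposition V & proposition V.

Arguments PTrue {V}.
Arguments PFalse {V}.

Definition valuation (V : Type) := V -> bool.

(* Truth values are booleans, so min, max and 1 - x are &&, || and ~~. *)
Fixpoint eval (V : Type) (f : valuation V) (phi : proposition V) : bool :=
  match phi with
  | PVar p => f p
  | PTrue => true
  | PFalse => false
  | PNot a => ~~ eval f a
  | PAnd a b => eval f a && eval f b
  | POr a b => eval f a || eval f b
  | PImp a b => ~~ eval f a || eval f b
  end.

Definition is_true_prop (V : Type) (phi : proposition V) : Prop :=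
  forall f : valuation V, eval f phi = true.

(* [Pos p] is the literal p and [Neg p] is its negation. *)
Inductive atom (V : Type) : Type :=
  | Pos of V
  | Neg of V
  | One
  | Zero.

Arguments One {V}.
Arguments Zero {V}.

Definition dual (V : Type) (a : atom V) : atom V :=
  match a with
  | Pos p => Neg p
  | Neg p => Pos p
  | One => Zero
  | Zero => One
  end.

Definition is_literal (V : Type) (a : atom V) : bool :=
  match a with Pos _ | Neg _ => true | One | Zero => false end.

(* The constants 0 and 1 are dual atoms but not dual literals. *)
Definition dual_literals (V : Type) (a b : atom V) : Prop :=
  [/\ is_literal a, is_literal b & b = dual a].

(* A graph may be empty; an edge set of two-element subsets is represented by
   its symmetric irreflexive adjacency relation. *)
Record graph : Type := Graph {
  vertex :> finType;
  edge : rel vertex;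
  edge_sym : symmetric edge;
  edge_irr : irreflexive edge
}.

Arguments edge {g} _ _.

Definition homomorphism (G G' : graph) (h : G -> G') : Prop :=
  forall v w : G, edge v w -> edge (h v) (h w).

Definition skew_fibration (G G' : graph) (h : G -> G') : Prop :=
  homomorphism h /\
  forall (v : G) (w : G'), edge (h v) w ->
    exists w' : G, edge v w' /\ ~~ edge (h w') w.

Definition cograph (G : graph) : Prop :=
  0 < #|G| /\
  forall v w x y : G, uniq [:: v; w; x; y] ->
    ~ [/\ [/\ edge v w, edge w x & edge x y] &
          [/\ ~~ edge v x, ~~ edge v y & ~~ edge w y]].

Definition graph_point : graph :=
  @Graph unit (fun _ _ => false) (fun _ _ => erefl) (fun _ => erefl).

Section Complement.

Variable G : graph.

Definition compl_edge : rel G := fun v w => (v != w) && ~~ edge v w.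

Fact compl_edge_sym : symmetric compl_edge.
Proof. by move=> v w; rewrite /compl_edge eq_sym edge_sym. Qed.

Fact compl_edge_irr : irreflexive compl_edge.
Proof. by move=> v; rewrite /compl_edge eqxx. Qed.

Definition graph_compl : graph := Graph compl_edge_sym compl_edge_irr.

End Complement.

Section UnionJoin.

Variables G G' : graph.

(* Union for [cross = false], join for [cross = true]; the sum type makes the
   vertex sets disjoint. *)
Definition sum_edge (cross : bool) : rel (G + G')%type := fun v w =>
  match v, w with
  | inl a, inl b => edge a b
  | inr a, inr b => edge a b
  | _, _ => cross
  end.

Fact sum_edge_sym (cross : bool) : symmetric (sum_edge cross).
Proof. by move=> [v|v] [w|w] //=; rewrite edge_sym. Qed.

Fact sum_edge_irr (cross : bool) : irreflexive (sum_edge cross).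
Proof. by move=> [v|v] /=; rewrite edge_irr. Qed.

Definition graph_union : graph :=
  Graph (sum_edge_sym false) (sum_edge_irr false).

Definition graph_join : graph :=
  Graph (sum_edge_sym true) (sum_edge_irr true).

End UnionJoin.

Record labelled_graph (V : Type) : Type := LabelledGraph {
  lgraph :> graph;
  label : lgraph -> atom V
}.

Arguments label {V l} _.

Definition lg_atom (V : Type) (a : atom V) : labelled_graph V :=
  @LabelledGraph V graph_point (fun _ => a).

Definition lg_not (V : Type) (G : labelled_graph V) : labelled_graph V :=
  @LabelledGraph V (graph_compl G) (fun v => dual (@label V G v)).

Definition sum_label (V : Type) (G G' : labelled_graph V)
    (v : (G + G')%type) : atom V :=
  match v with inl a => label a | inr b => label b end.

Definition lg_or (V : Type) (G G' : labelled_graph V) : labelled_graph V :=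
  @LabelledGraph V (graph_union G G') (@sum_label V G G').

Definition lg_and (V : Type) (G G' : labelled_graph V) : labelled_graph V :=
  @LabelledGraph V (graph_join G G') (@sum_label V G G').

Definition lg_imp (V : Type) (G G' : labelled_graph V) : labelled_graph V :=
  lg_or (lg_not G) G'.

(* No separate clause is needed for the atom "not p": complementing the one
   vertex labelled [Pos p] yields the one vertex labelled [Neg p]. *)
Fixpoint graph_of (V : Type) (phi : proposition V) : labelled_graph V :=
  match phi with
  | PVar p => lg_atom (Pos p)
  | PTrue => lg_atom One
  | PFalse => lg_atom Zero
  | PNot a => lg_not (graph_of a)
  | PAnd a b => lg_and (graph_of a) (graph_of b)
  | POr a b => lg_or (graph_of a) (graph_of b)
  | PImp a b => lg_imp (graph_of a) (graph_of b)
  end.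

Record coloured_graph : Type := ColouredGraph {
  cgraph :> graph;
  same_colour : rel cgraph;
  same_colour_equiv : equivalence_rel same_colour;
  same_colour_proper :
    forall v w : cgraph, v != w -> same_colour v w -> ~~ edge v w
}.

Definition colour_classes (C : coloured_graph) : {set {set C}} :=
  equivalence_partition (@same_colour C) [set: C].

Definition induces_matching (G : graph) (W : {set G}) : Prop :=
  W != set0 /\
  forall w : G, w \in W -> exists! w' : G, w' \in W /\ edge w w'.

(* [cover P] is the union of the classes in the family P. *)
Definition nicely_coloured (C : coloured_graph) : Prop :=
  (forall K : {set C}, K \in colour_classes C -> #|K| <= 2) /\
  (forall P : {set {set C}},
     P \subset [set K in colour_classes C | #|K| == 2] ->
     ~ induces_matching (cover P)).

Definition axiomatic (V : Type) (C : coloured_graph) (G : labelled_graph V)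
    (h : C -> G) (K : {set C}) : Prop :=
  (exists v : C, K = [set v] /\ label (h v) = One) \/
  (exists v w : C,
     [/\ v != w, K = [set v; w] & dual_literals (label (h v)) (label (h w))]).

Definition has_combinatorial_proof (V : Type) (phi : proposition V) : Prop :=
  exists (C : coloured_graph) (h : C -> graph_of phi),
    [/\ cograph C, nicely_coloured C, skew_fibration h &
        forall K : {set C}, K \in colour_classes C -> axiomatic h K].

(* Main.v *)
Require Import Defs.
From mathcomp Require Import all_boot.
From Stdlib Require Import Classical ClassicalEpsilon.

(* A proposition is false under f exactly when some maximal stable set W of its
   graph has only false labels.  Soundness: a skew fibration h between cographs
   pulls W back to a maximal stable set of C, which contains no axiomatic class
   entirely; following partner and then neighbour inside it gives a cycle, and a
   shortest such cycle induces a matching by the cograph condition.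
   Completeness: from proofs of A \/ R and B \/ R one obtains a proof of
   (A /\ B) \/ R by joining the preimages of A and B, a parity count showing
   that the colouring stays nice.  This reduces provability to the maximal stable
   sets, each of which contains an axiomatic class. *)

Set Implicit Arguments.
Unset Strict Implicit.
Unset Printing Implicit Defensive.

(** * Induced paths and maximal homogeneous sets *)

Definition p4_free (G : graph) (X : {set G}) : Prop :=
  forall v w x y : G, v \in X -> w \in X -> x \in X -> y \in X ->
    edge v w -> edge w x -> edge x y ->
    ~~ edge v x -> ~~ edge v y -> ~~ edge w y -> False.

(** The edges and non-edges of the pattern already force the four vertices apart, so [p4_free] can
    omit distinctness. *)
Lemma cograph_p4_free (G : graph) : cograph G -> p4_free [set: G].
Proof.
move=> [_ P4] v w x y _ _ _ _ vw wx xy vx vy wy; apply: (P4 v w x y) => //.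
rewrite /= !inE !negb_or !andbT.
do ![apply/andP; split]; apply/eqP => E; subst.
- by rewrite edge_irr in vw.
- by rewrite xy in vy.
- by rewrite edge_sym vw in wy.
- by rewrite edge_irr in wx.
- by rewrite vw in vy.
- by rewrite edge_irr in xy.
Qed.

Lemma p4_free_cograph (G : graph) :
  0 < #|G| -> p4_free [set: G] -> cograph G.
Proof.
move=> G0 P4; split=> // v w x y _ [[vw wx xy] [vx vy wy]].
by apply: (P4 v w x y); rewrite ?inE.
Qed.

(* Maximal stable subsets of [X] for [b = false], maximal cliques for
   [b = true]. *)
Definition max_homog (G : graph) (b : bool) (X S : {set G}) : Prop :=
  [/\ S != set0, S \subset X,
      {in S &, forall x y, x != y -> edge x y = b} &
      forall x, x \in X -> x \notin S -> exists2 y, y \in S & edge x y = ~~ b].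

Lemma max_stableN (G : graph) (X S : {set G}) x y :
  max_homog false X S -> x \in S -> y \in S -> edge x y = false.
Proof.
move=> [_ _ st _] xS yS; case: (eqVneq x y) => [->|]; first exact: edge_irr.
exact: st.
Qed.

(** * Cotree decompositions *)

(** The Boolean [b] selects join ([true]) or union ([false]); the clause [x != y] makes the two
    parts disjoint. *)
Inductive cotree (G : graph) : {set G} -> Prop :=
  | cotree1 x : cotree [set x]
  | cotreeU b (A B : {set G}) : cotree A -> cotree B ->
      {in A & B, forall x y, x != y /\ edge x y = b} -> cotree (A :|: B).

Lemma cotree_neq0 (G : graph) (X : {set G}) : cotree X -> X != set0.
Proof.
elim=> [x|b A B _ A0 _ _ _]; first by apply/set0Pn; exists x; rewrite inE.
by rewrite setU_eq0 negb_and A0.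
Qed.

Lemma cotree_compl (G : graph) (X : {set G}) :
  cotree X -> @cotree (graph_compl G) X.
Proof.
elim=> [x|b A B _ cA _ cB AB]; first exact: (@cotree1 (graph_compl G)).
apply: (@cotreeU (graph_compl G) (~~ b)) => // x y xA yB.
by have [xy <-] := AB x y xA yB; rewrite /= /compl_edge xy.
Qed.

Lemma cotree_imset (G G' : graph) (h : G -> G') (X : {set G}) :
  injective h -> (forall x y, edge (h x) (h y) = edge x y) ->
  cotree X -> cotree (h @: X).
Proof.
move=> inj hE; elim=> [x|b A B _ cA _ cB AB]; first by rewrite imset_set1; left.
rewrite imsetU; apply: (@cotreeU _ b) => // _ _ /imsetP[x xA ->] /imsetP[y yB ->].
by rewrite hE (inj_eq inj); apply: AB.
Qed.

Definition graph_sum (c : bool) (G G' : graph) : graph :=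
  Graph (@sum_edge_sym G G' c) (@sum_edge_irr G G' c).

Lemma cotree_sum c (G G' : graph) :
  cotree [set: G] -> cotree [set: G'] -> cotree [set: graph_sum c G G'].
Proof.
move=> cG cG'.
have -> : [set: graph_sum c G G'] = (inl @: [set: G]) :|: (inr @: [set: G']).
  by apply/setP => -[x|x]; rewrite !inE; apply/esym/orP; [left | right];
    apply: imset_f.
apply: (@cotreeU _ c).
- by apply: (@cotree_imset G (graph_sum c G G')) => // x y [].
- by apply: (@cotree_imset G' (graph_sum c G G')) => // x y [].
by move=> _ _ /imsetP[x _ ->] /imsetP[y _ ->].
Qed.

Lemma graph_of_cotree (V : Type) (phi : proposition V) :
  cotree [set: graph_of phi].
Proof.
have pt : cotree [set: graph_point].
  have -> : [set: graph_point] = [set tt] by apply/setP => -[]; rewrite !inE.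
  by left.
elim: phi => [p|||a ca|a ca b cb|a ca b cb|a ca b cb] //.
- exact: cotree_compl.
- exact: (@cotree_sum true).
- exact: (@cotree_sum false).
- by apply: (@cotree_sum false) => //; apply: cotree_compl.
Qed.

Lemma cotree_p4_free (G : graph) (X : {set G}) : cotree X -> p4_free X.
Proof.
elim=> [x|b A B _ IA _ IB AB] v w y z.
  by rewrite !inE => /eqP-> /eqP-> _ _; rewrite edge_irr.
have half x t : x \in A :|: B -> t \in A :|: B -> edge x t = ~~ b ->
    x \in A -> t \in A.
  move=> _; rewrite [t \in _]inE => /orP[//|tB] xt xA.
  by have [_] := AB x t xA tB; rewrite xt; case: (b).
have side x t : x \in A :|: B -> t \in A :|: B -> edge x t = ~~ b ->
    (x \in A) = (t \in A).
  by move=> xX tX xt; apply/idP/idP; apply: half; rewrite // edge_sym.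
move=> vX wX yX zX vw wy yz vy vz wz.
have [wA yA zA] : [/\ (w \in A) = (v \in A), (y \in A) = (v \in A) &
    (z \in A) = (v \in A)].
  case: (b) side => side.
    have vzA := side v z vX zX (negbTE vz).
    by rewrite -(side v y vX yX (negbTE vy)) (side w z wX zX (negbTE wz)) vzA.
  by rewrite -(side y z) // -(side w y) // (side v w).
move: vX wX yX zX; rewrite !inE wA yA zA.
case: (boolP (v \in A)) wA yA zA => /= vA wA yA zA vX wX yX zX.
  exact: (IA v w y z).
exact: (IB v w y z).
Qed.

Lemma max_homog_setI (G : graph) (b : bool) (A B T : {set G}) :
  A != set0 -> {in A & B, forall x y, x != y /\ edge x y = b} ->
  max_homog b (A :|: B) T -> max_homog b A (T :&: A).
Proof.
move=> /set0Pn[a aA] AB [_ TX hom dom].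
have domA x : x \in A -> x \notin T -> exists2 y, y \in T :&: A & edge x y = ~~ b.
  move=> xA xT; have [|y yT xy] := dom x _ xT; first by rewrite inE xA.
  exists y => //; rewrite inE yT /=; have := subsetP TX _ yT.
  rewrite inE => /orP[//|yB]; have [_] := AB x y xA yB.
  by rewrite xy; case: (b).
split=> [||x y|x xA].
- apply/set0Pn; have [aT|aT] := boolP (a \in T).
    by exists a; rewrite inE aT.
  by have [y yT _] := domA a aA aT; exists y.
- exact: subsetIr.
- by rewrite !inE => /andP[xT _] /andP[yT _]; apply: hom.
- by rewrite inE xA andbT; apply: domA.
Qed.

Lemma max_homog_side (G : graph) (b : bool) (A B T : {set G}) :
  {in A & B, forall x y, x != y /\ edge x y = ~~ b} ->
  max_homog b (A :|: B) T -> max_homog b A T \/ max_homog b B T.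
Proof.
move=> AB [T0 TX hom dom].
have [TA|/subsetPn[y yT yA]] := boolP (T \subset A); [left|right]; split=> //.
- by move=> x xA; apply: dom; rewrite inE xA.
- have yB : y \in B by have := subsetP TX _ yT; rewrite inE (negbTE yA).
  apply/subsetP => x xT; have := subsetP TX _ xT; rewrite inE => /orP[xA|//].
  by have [xy] := AB x y xA yB; rewrite (hom x y xT yT xy); case: (b).
- by move=> x xB; apply: dom; rewrite inE xB orbT.
Qed.

(** One of the two sets restricts to a maximal set in each part, the other lies within one part;
    induction on that part gives the common vertex. In a P4 the middle edge and the two ends would
    be a disjoint pair. *)
Lemma max_clique_stable_meet (G : graph) (X K S : {set G}) :
  cotree X -> max_homog true X K -> max_homog false X S ->
  exists2 x, x \in K & x \in S.
Proof.
move=> cX; elim: cX K S => [x|b A B cA IA cB IB AB] K S.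
  move=> [/set0Pn[y yK] /subsetP Kx _ _] [/set0Pn[z zS] /subsetP Sx _ _].
  by exists x; [move: yK (Kx y yK) | move: zS (Sx z zS)]; rewrite inE => + /eqP<-.
have BA : {in B & A, forall x y, x != y /\ edge x y = b}.
  by move=> x y xB yA; rewrite eq_sym edge_sym; apply: AB.
have meet (K' S' : {set G}) : K' \subset K -> S' \subset S ->
    (exists2 x, x \in K' & x \in S') -> exists2 x, x \in K & x \in S.
  by move=> /subsetP K'K /subsetP S'S [x /K'K xK /S'S xS]; exists x.
case: b AB BA => AB BA mK mS.
  have KA := max_homog_setI (cotree_neq0 cA) AB mK.
  have KB : max_homog true B (K :&: B).
    by apply: (max_homog_setI (cotree_neq0 cB) BA); rewrite setUC.
  by case: (@max_homog_side _ false _ _ _ AB mS) => S';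
    [apply: meet (IA _ _ KA S') | apply: meet (IB _ _ KB S')];
    rewrite ?subsetIl.
have SA := max_homog_setI (cotree_neq0 cA) AB mS.
have SB : max_homog false B (S :&: B).
  by apply: (max_homog_setI (cotree_neq0 cB) BA); rewrite setUC.
by case: (@max_homog_side _ true _ _ _ AB mK) => K';
  [apply: meet (IA _ _ K' SA) | apply: meet (IB _ _ K' SB)];
  rewrite ?subsetIl.
Qed.

(** * Truth values and maximal homogeneous sets *)

Definition eval_atom (V : Type) (f : valuation V) (a : atom V) : bool :=
  match a with Pos p => f p | Neg p => ~~ f p | One => true | Zero => false end.

Lemma eval_atom_dual (V : Type) (f : valuation V) (a : atom V) :
  eval_atom f (dual a) = ~~ eval_atom f a.
Proof. by case: a => //= p; rewrite negbK. Qed.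

(** A certificate for the truth value [b]: a maximal clique of true labels, or a maximal stable set
    of false ones. *)
Definition decides (V : Type) (f : valuation V) (G : labelled_graph V)
    (b : bool) : Prop :=
  exists S : {set G}, max_homog b [set: G] S /\
    {in S, forall v, eval_atom f (label v) = b}.

Definition lg_sum (V : Type) (c : bool) (G G' : labelled_graph V) :
    labelled_graph V :=
  @LabelledGraph V (graph_sum c G G') (@sum_label V G G').

Section Decides.
Variables (V : Type) (f : valuation V).
Implicit Types G : labelled_graph V.

Lemma decides_atom a : decides f (lg_atom a) (eval_atom f a).
Proof.
exists [set: graph_point]; split=> //; split=> //.
- by apply/set0Pn; exists tt; rewrite inE.
- by move=> x; rewrite inE.
Qed.

Lemma decides_not G b : decides f G b -> decides f (lg_not G) (~~ b).
Proof.
move=> [S [[S0 SX hom dom] lab]]; exists S; split; last first.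
  by move=> v vS; rewrite /= eval_atom_dual lab.
split=> // [x y xS yS xy|x _ xS].
  by rewrite /= /compl_edge xy /= hom.
have [|y yS xy] := dom x _ xS; first by rewrite inE.
exists y => //; rewrite /= /compl_edge xy negbK.
by have -> // : x != y by apply: contraNneq xS => ->.
Qed.

Lemma decides_sum_both c G G' :
  decides f G c -> decides f G' c -> decides f (lg_sum c G G') c.
Proof.
move=> [S [[/set0Pn[s sS] SX hom dom] lab]] [S' [[_ SX' hom' dom'] lab']].
pose T : {set lg_sum c G G'} :=
  [set x | match x with inl y => y \in S | inr y => y \in S' end].
exists T; split; last by move=> [v|v]; rewrite inE; [apply: lab | apply: lab'].
split=> //.
- by apply/set0Pn; exists (inl s); rewrite inE.
- by move=> [x|x] [y|y]; rewrite !inE //=; [apply: hom | apply: hom'].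
- move=> [x|x] _; rewrite inE => xT.
    by have [|y yS xy] := dom x _ xT; rewrite ?inE //; exists (inl y); rewrite ?inE.
  by have [|y yS xy] := dom' x _ xT; rewrite ?inE //; exists (inr y); rewrite ?inE.
Qed.

(** One summand suffices for the value [~~ c]: every cross pair has edge value [c], so any member of
    [S] dominates the whole other summand. *)
Lemma decides_suml c G G' :
  decides f G (~~ c) -> decides f (lg_sum c G G') (~~ c).
Proof.
move=> [S [[/set0Pn[s sS] SX hom dom] lab]].
pose T : {set lg_sum c G G'} :=
  [set x | match x with inl y => y \in S | inr y => false end].
exists T; split; last by move=> [v|v]; rewrite inE //; apply: lab.
split=> //.
- by apply/set0Pn; exists (inl s); rewrite inE.
- by move=> [x|x] [y|y]; rewrite !inE //=; apply: hom.
- move=> [x|x] _; rewrite inE => xT.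
    by have [|y yS xy] := dom x _ xT; rewrite ?inE //; exists (inl y); rewrite ?inE.
  by exists (inl s); rewrite ?inE //= negbK.
Qed.

Lemma decides_sumr c G G' :
  decides f G' (~~ c) -> decides f (lg_sum c G G') (~~ c).
Proof.
move=> [S [[/set0Pn[s sS] SX hom dom] lab]].
pose T : {set lg_sum c G G'} :=
  [set x | match x with inl y => false | inr y => y \in S end].
exists T; split; last by move=> [v|v]; rewrite inE //; apply: lab.
split=> //.
- by apply/set0Pn; exists (inr s); rewrite inE.
- by move=> [x|x] [y|y]; rewrite !inE //=; apply: hom.
- move=> [x|x] _; rewrite inE => xT.
    by exists (inr s); rewrite ?inE //= negbK.
  by have [|y yS xy] := dom x _ xT; rewrite ?inE //; exists (inr y); rewrite ?inE.
Qed.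

Lemma decides_or G G' b b' :
  decides f G b -> decides f G' b' -> decides f (lg_or G G') (b || b').
Proof.
case: b => [dG _|]; first exact: (@decides_suml false).
case: b' => [_ dG'|]; first exact: (@decides_sumr false).
exact: (@decides_sum_both false).
Qed.

Lemma decides_and G G' b b' :
  decides f G b -> decides f G' b' -> decides f (lg_and G G') (b && b').
Proof.
case: b => [|dG _]; last exact: (@decides_suml true).
case: b' => [|_ dG']; last exact: (@decides_sumr true).
exact: (@decides_sum_both true).
Qed.

Lemma eval_decides (phi : proposition V) :
  decides f (graph_of phi) (eval f phi).
Proof.
elim: phi => [p|||a IH|a IHa b IHb|a IHa b IHb|a IHa b IHb] /=.
- exact: (decides_atom (Pos p)).
- exact: (decides_atom One).
- exact: (decides_atom Zero).
- exact: decides_not.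
- exact: decides_and.
- exact: decides_or.
- by apply: decides_or => //; apply: decides_not.
Qed.

End Decides.

(** * Soundness *)

(* Induction on the number of neighbours of [h v] in [W], which decreases along a
   well-chosen neighbour [x] of [v]; a neighbour [u] of [x] over [W] must be
   adjacent to [v] because [u - x - v - x2] would otherwise be a P4. *)
Lemma skew_preim_dominating (G G' : graph) (h : G -> G') (W : {set G'}) :
  p4_free [set: G] -> p4_free [set: G'] -> skew_fibration h ->
  max_homog false [set: G'] W ->
  forall v, h v \notin W -> exists2 u, edge v u & h u \in W.
Proof.
move=> P4G P4G' [hom skew] mW.
have P4 := P4G' _ _ _ _ (in_setT _) (in_setT _) (in_setT _) (in_setT _).
have {P4G}P4G := P4G _ _ _ _ (in_setT _) (in_setT _) (in_setT _) (in_setT _).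
have {P4}P4G' := P4.
have stW := max_stableN mW.
have [_ _ _ domW] := mW.
pose N v := [set w in W | edge (h v) w].
have inN v w : (w \in N v) = (w \in W) && edge (h v) w by rewrite inE.
have N0 v : h v \notin W -> N v != set0.
  move=> vW; have [|w wW vw] := domW (h v) _ vW; rewrite ?inE //.
  by apply/set0Pn; exists w; rewrite inN wW.
move=> v; move: {2}#|N v| (leqnn #|N v|) => n; elim: n v => [|n IH] v leN vW.
  by move: (N0 v vW); rewrite -cards_eq0 -leqn0 leN.
have lift w : w \in N v -> exists2 x, edge v x & (N x \proper N v) && (w \notin N x).
  rewrite inN => /andP[wW vw]; have [x [vx xw]] := skew v w vw.
  exists x => //; rewrite inN wW xw andbT properE; apply/andP; split; last first.
    by apply/subsetPn; exists w; rewrite inN wW.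
  (* A [z] in [N x] outside [N v] would give the P4 [w - h v - h x - z]. *)
  apply/subsetP => z; rewrite !inN => /andP[zW xz]; rewrite zW /=.
  apply: contraT => vz; exfalso; apply: (P4G' w (h v) (h x) z) => //.
  - by rewrite edge_sym.
  - exact: hom.
  - by rewrite edge_sym.
  - by rewrite stW.
have /set0Pn[w0 w0N] := N0 v vW.
have [x0 vx0 /andP[x0N _]] := lift w0 w0N.
pose P x := edge v x && (N x \proper N v).
have Px0 : P x0 by rewrite /P vx0.
(* Minimality prevents [N x2] from being properly contained in [N x]; this supplies the [w3] that,
   with [w2], keeps [h x] and [h x2] nonadjacent. *)
case: (arg_minnP (fun x => #|N x|) Px0) => x /andP[vx xN] min_x.
have [xW|xW] := boolP (h x \in W); first by exists x.
have /set0Pn[w2 w2x] := N0 x xW.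
have [x2 vx2 /andP[x2N w2x2]] := lift w2 (subsetP (proper_sub xN) _ w2x).
have /subsetPn[w3 w3x2 w3x] : ~~ (N x2 \subset N x).
  apply/negP => sub; have /proper_card : N x2 \proper N x.
    by rewrite properE sub; apply/subsetPn; exists w2.
  by rewrite ltnNge min_x // /P vx2.
have [w2W hxw2] : w2 \in W /\ edge (h x) w2 by move: w2x; rewrite inN => /andP[].
have [w3W hx2w3] : w3 \in W /\ edge (h x2) w3 by move: w3x2; rewrite inN => /andP[].
rewrite inN w2W /= in w2x2; rewrite inN w3W /= in w3x.
have xx2 : ~~ edge (h x) (h x2).
  apply/negP => xx2; apply: (P4G' w2 (h x) (h x2) w3) => //.
  - by rewrite edge_sym.
  - by rewrite edge_sym.
  - by rewrite stW.
have disj w4 : w4 \in W -> edge (h x) w4 -> ~~ edge (h x2) w4.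
  move=> w4W xw4; apply/negP => x2w4; apply: (P4G' w2 (h x) w4 (h x2)) => //.
  - by rewrite edge_sym.
  - by rewrite edge_sym.
  - by rewrite stW.
  - by rewrite edge_sym.
have [|//|u xu uW] := IH x.
  by rewrite -ltnS; apply: leq_trans leN; apply: proper_card.
exists u => //; apply: contraT => vu; exfalso; apply: (P4G u x v x2) => //.
- by rewrite edge_sym.
- by rewrite edge_sym.
- by rewrite edge_sym.
- apply/negP => /hom ux2; have /negP := disj _ uW (hom _ _ xu); apply.
  by rewrite edge_sym.
- by apply: contra xx2; apply: hom.
Qed.

(* A minimal subset of [S] closed under [v |-> u] for [edge (s v) u] is a chordless
   alternating cycle, and by [p4_free] it induces a matching. *)
Lemma stable_transversal_matching (G : graph) (S : {set G}) (s : G -> G) :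
  p4_free [set: G] -> S != set0 ->
  {in S &, forall x y, edge x y = false} ->
  {in S, forall x, s x \notin S} ->
  {in S, forall x, exists2 u, u \in S & edge (s x) u} ->
  exists2 T : {set G}, T \subset S & induces_matching (T :|: s @: T).
Proof.
move=> P4 S0 st sS dom.
have {}P4 := P4 _ _ _ _ (in_setT _) (in_setT _) (in_setT _) (in_setT _).
pose closed (T : {set G}) := [&& T != set0, T \subset S &
  [forall v in T, exists u in T, edge (s v) u]].
have closedS : exists T, closed T.
  exists S; rewrite /closed S0 subxx; apply/forall_inP => v vS.
  by have [u uS vu] := dom v vS; apply/exists_inP; exists u.
have [T /minsetP[/and3P[T0 TS /forall_inP clT] minT]] := ex_minset closedS.
have {}clT v : v \in T -> exists2 u, u \in T & edge (s v) u.
  by move=> /clT/exists_inP.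
(* The image of a successor choice [g] is closed again, so minimality makes [g] a permutation of
   [T]. *)
have onto (g : G -> G) : {in T, forall v, g v \in T /\ edge (s v) (g v)} ->
    g @: T = T.
  move=> gT; apply: minT; last by apply/subsetP => _ /imsetP[v /gT[? _] ->].
  apply/and3P; split.
  - by have /set0Pn[v vT] := T0; apply/set0Pn; exists (g v); apply: imset_f.
  - apply: subset_trans TS; apply/subsetP => _ /imsetP[v /gT[? _] ->] //.
  - apply/forall_inP => _ /imsetP[v /gT[gvT _] ->]; apply/exists_inP.
    by exists (g (g v)); [apply: imset_f | case: (gT _ gvT)].
(* [g u] selects [u] whenever it is a successor. Injectivity of this choice then bounds in-degrees,
   and surjectivity out-degrees, by one; the default [v] never occurs on [T]. *)
pose g u v := if edge (s v) u then u else odflt v [pick y in T | edge (s v) y].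
have gT u : u \in T -> {in T, forall v, g u v \in T /\ edge (s v) (g u v)}.
  move=> uT v vT; rewrite /g; case: ifP => // _.
  case: pickP => [y /andP[]//|none]; have [y yT vy] := clT v vT.
  by have := none y; rewrite yT vy.
have indeg v v1 u : v \in T -> v1 \in T -> u \in T ->
    edge (s v) u -> edge (s v1) u -> v = v1.
  move=> vT v1T uT vu v1u; have /imset_injP inj : #|g u @: T| == #|T|.
    by rewrite (onto _ (gT u uT)).
  by apply: inj; rewrite // /g vu v1u.
have outdeg v u1 u2 : v \in T -> u1 \in T -> u2 \in T ->
    edge (s v) u1 -> edge (s v) u2 -> u1 = u2.
  move=> vT u1T u2T vu1 vu2; have := u2T; rewrite -{1}(onto _ (gT u1 u1T)).
  move=> /imsetP[x xT u2E]; have [_ xu2] := gT u1 u1T x xT.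
  rewrite -u2E in xu2; have xv := indeg _ _ _ xT vT u2T xu2 vu2.
  by rewrite u2E xv /g vu1.
have stT x y : x \in T -> y \in T -> edge x y = false.
  by move=> xT yT; apply: st; apply: (subsetP TS).
exists T => //; split.
  by have /set0Pn[v vT] := T0; apply/set0Pn; exists v; rewrite inE vT.
move=> w; rewrite inE => /orP[wT|/imsetP[v vT ->{w}]].
  have := wT; rewrite -{1}(onto _ (gT w wT)) => /imsetP[x xT wE].
  have [_ xw] := gT w wT x xT; rewrite -wE in xw.
  exists (s x); split; first by rewrite inE imset_f ?orbT // edge_sym.
  move=> w' []; rewrite inE => /orP[w'T|/imsetP[y yT ->]]; first by rewrite stT.
  by rewrite edge_sym => yw; rewrite (indeg _ _ _ xT yT wT).
have [u uT vu] := clT v vT.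
exists u; split; first by rewrite inE uT.
move=> w' []; rewrite inE => /orP[w'T vw'|/imsetP[y yT ->] vy].
  exact: outdeg vu vw'.
have [uy uyT yuy] := clT y yT.
have vNy : v <> y by move=> E; rewrite E edge_irr in vy.
exfalso; apply: (P4 u (s v) (s y) uy) => //.
- by rewrite edge_sym.
- by rewrite edge_sym; apply/negP => yu; apply: vNy; apply: (indeg _ _ u).
- by rewrite stT.
- by apply/negP => vuy; apply: vNy; apply: (indeg _ _ uy).
Qed.

Definition colour_class (C : coloured_graph) (v : C) : {set C} :=
  [set w in [set: C] | same_colour v w].

Lemma in_colour_class (C : coloured_graph) (v w : C) :
  (w \in colour_class v) = same_colour v w.
Proof. by rewrite !inE. Qed.

Lemma colour_classP (C : coloured_graph) (K : {set C}) :
  reflect (exists v, K = colour_class v) (K \in colour_classes C).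
Proof.
rewrite /colour_classes /equivalence_partition.
by apply: (iffP imsetP) => [[v _ ->]|[v ->]]; exists v.
Qed.

Lemma combinatorial_proof_sound (V : Type) (phi : proposition V) :
  has_combinatorial_proof phi -> is_true_prop phi.
Proof.
move=> [C [h [cC [_ nice] sk ax]]] f; case E: (eval f phi) => //; exfalso.
have [W [mW lab]] := eval_decides f phi; rewrite E in mW lab.
pose S := h @^-1: W.
(* The colour partner, with [v] itself as default; on [S] a partner exists, since a singleton class
   is labelled [1] while [W] has only false labels. *)
pose s (v : C) := odflt v [pick w | (w != v) && same_colour v w].
have refl (v : C) : same_colour v v by have [] := @same_colour_equiv C v v v.
have sP v : v \in S -> [/\ s v != v, s v \notin S &
    colour_class v = [set v; s v]].
  rewrite inE => vS; have vv : v \in colour_class v by rewrite in_colour_class.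
  have clv : colour_class v \in colour_classes C.
    by apply/colour_classP; exists v.
  have two x y : x != y -> colour_class v = [set x; y] ->
      dual_literals (label (h x)) (label (h y)) ->
      exists w, [/\ w != v, colour_class v = [set v; w] & h w \notin W].
    move=> xy cl [_ _ yx]; have yxE := congr1 (eval_atom f) yx.
    rewrite eval_atom_dual in yxE.
    move: vv; rewrite cl !inE => /orP[]/eqP vE.
      exists y; rewrite vE eq_sym; split=> //.
      by apply/negP => yW; rewrite -vE !lab in yxE.
    exists x; rewrite vE setUC; split=> //.
    by apply/negP => xW; rewrite -vE !lab in yxE.
  have {two} [w [wv cl wW]] : exists w, [/\ w != v,
      colour_class v = [set v; w] & h w \notin W].
    have [[x [cl x1]]|[x [y [xy cl xyd]]]] := ax _ clv; last exact: two xyd.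
    by move: vv (lab _ vS); rewrite cl inE => /eqP->; rewrite x1.
  have cl_in y : (y == v) || (y == w) = same_colour v y.
    by rewrite -in_colour_class cl !inE.
  have -> : s v = w.
    rewrite /s; case: pickP => [y /=|/(_ w)]; last first.
      by rewrite wv /= -cl_in eqxx orbT.
    by rewrite -cl_in => /andP[/negbTE-> /=] /eqP.
  by rewrite inE.
have preim v : h v \notin W -> exists2 u, edge v u & h u \in W.
  exact: skew_preim_dominating (cograph_p4_free cC)
    (cotree_p4_free (graph_of_cotree phi)) sk mW v.
have [||x y|x xS|x xS|T TS mT] := @stable_transversal_matching C S s.
- exact: cograph_p4_free.
- have [/card_gt0P[v _] _] := cC; have [vW|vW] := boolP (h v \in W).
    by apply/set0Pn; exists v; rewrite inE.
  by have [u _ uW] := preim v vW; apply/set0Pn; exists u; rewrite inE.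
- rewrite !inE => xW yW; apply/negP => /sk.1.
  by rewrite (max_stableN mW).
- by have [] := sP x xS.
- have [_ sxS _] := sP x xS.
  rewrite inE in sxS; have [u xu uW] := preim _ sxS.
  by exists u; rewrite ?inE.
have PT : @colour_class C @: T \subset
    [set K in colour_classes C | #|K| == 2].
  apply/subsetP => _ /imsetP[v vT ->]; rewrite inE; apply/andP; split.
    by apply/colour_classP; exists v.
  have [svv _ ->] := sP v (subsetP TS v vT).
  by rewrite cards2 (eq_sym v) svv.
apply: (nice _ PT).
suff -> : cover (@colour_class C @: T) = T :|: s @: T by [].
rewrite cover_imset; apply/setP => w; apply/bigcupP/idP => [[v vT]|].
  have [_ _ ->] := sP v (subsetP TS v vT).
  by rewrite !inE => /orP[]/eqP->; rewrite ?vT // imset_f ?orbT.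
rewrite inE => /orP[wT|/imsetP[v vT ->]]; first by exists w; rewrite ?in_colour_class.
exists v => //; have [_ _ ->] := sP v (subsetP TS v vT).
by rewrite !inE eqxx orbT.
Qed.

(** * Completeness *)

(* A combinatorial proof of the subgraph induced by [U], its colouring given by
   an involution [s] whose orbits are the colour classes. *)
Definition proof_on (V : Type) (G : labelled_graph V) (U : {set G})
    (C : graph) (s : C -> C) (h : C -> G) : Prop :=
  [/\ [/\ 0 < #|C|, p4_free [set: C], involutive s & forall v, ~~ edge v (s v)],
      forall W : {set C}, (forall w, w \in W -> s w \in W /\ s w != w) ->
        ~ induces_matching W,
      [/\ homomorphism h, forall v, h v \in U &
        forall v w, w \in U -> edge (h v) w ->
          exists2 w', edge v w' & ~~ edge (h w') w] &
      forall v, if s v == v then label (h v) = One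
        else dual_literals (label (h v)) (label (h (s v)))].

Definition provable_on (V : Type) (G : labelled_graph V) (U : {set G}) : Prop :=
  exists (C : graph) (s : C -> C) (h : C -> G), proof_on U s h.

Lemma provable_on_setT (V : Type) (phi : proposition V) :
  provable_on [set: graph_of phi] -> has_combinatorial_proof phi.
Proof.
move=> [C [s [h [[C0 P4 inv sN] nice [hom hU skew] ax]]]].
pose r : rel C := fun v w => (w == v) || (w == s v).
have r_equiv : equivalence_rel r.
  move=> x y z; split; first by rewrite /r eqxx.
  by case/orP=> /eqP ->; rewrite /r ?inv // orbC.
have r_proper v w : v != w -> r v w -> ~~ edge v w.
  by rewrite /r eq_sym => /negbTE-> /= /eqP->.
pose D := ColouredGraph r_equiv r_proper.
have classE (K : {set D}) : K \in colour_classes D -> exists v : C, K = [set v; s v].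
  move=> /colour_classP[v ->]; exists v; apply/setP => w.
  by rewrite in_colour_class !inE.
exists D, h; split.
- exact: p4_free_cograph.
- split=> [K /classE[v ->]|P /subsetP PS].
    by rewrite cards2; case: (_ == _).
  apply: nice => w /bigcupP[K KP wK].
  have := PS K KP; rewrite inE => /andP[/classE[v KE]]; rewrite KE cards2 => vs.
  have {}vs : v != s v by case: (v =P s v) vs.
  rewrite KE !inE in wK; split.
    apply/bigcupP; exists K => //; rewrite KE !inE.
    by case/orP: wK => /eqP->; rewrite ?inv eqxx ?orbT.
  by case/orP: wK => /eqP->; rewrite ?inv // eq_sym.
- split=> // v w vw; have [w' vw' w'w] := skew v w (in_setT w) vw.
  by exists w'.
- move=> K /classE[v ->]; have := ax v; case: eqP => [->|/eqP vs d].
    by left; exists v; rewrite setUid.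
  by right; exists v, (s v); rewrite eq_sym.
Qed.

(** A single vertex or one two-vertex class serves as the cograph: [S] has no inner edges, so
    nothing needs lifting, and the edgeless source admits no matching. *)
Lemma provable_on_stable (V : Type) (G : labelled_graph V) (S : {set G}) :
  {in S &, forall x y, edge x y = false} ->
  (exists2 v, v \in S & label v = One) \/
  (exists v w, [/\ v \in S, w \in S & dual_literals (label v) (label w)]) ->
  provable_on S.
Proof.
move=> st [[v vS v1]|[v [w [vS wS vw]]]].
  exists graph_point, id, (fun=> v); split.
  - by split=> //; rewrite card_unit.
  - move=> W _ [/set0Pn[x xW] m]; by have [y [[]]] := m x xW.
  - by split=> // [[]] x xS; rewrite st.
  - by move=> [].
pose E : rel bool := fun _ _ => false.
have [Es Ei] : symmetric E /\ irreflexive E by split.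
exists (Graph Es Ei), negb, (fun b => if b then v else w); split.
- by split=> //; [rewrite card_bool | exact: negbK].
- move=> W _ [/set0Pn[x xW] m]; by have [y [[]]] := m x xW.
- by split=> // [[]|[] x xS] //; rewrite st.
- case=> //=; case: vw => v1 w1 vwE; split=> //.
  by rewrite vwE; case: (label v).
Qed.

(** Vertices of [U'] outside [U] are adjacent to no image vertex, so they impose no lifting
    condition. *)
Lemma proof_on_change (V : Type) (G : labelled_graph V) (U U' : {set G})
    (C : graph) (s : C -> C) (h : C -> G) :
  (forall v, h v \in U') ->
  (forall v w, w \in U' -> w \notin U -> edge (h v) w = false) ->
  proof_on U s h -> proof_on U' s h.
Proof.
move=> hU' sep [gr nice [hom hU skew] ax]; split=> //; split=> // v w wU' vw.
by apply: skew => //; apply: contraT => wU; rewrite sep in vw.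
Qed.

(** Orbits [{x, s x}] are removed one at a time. All hypotheses are local to [W], because the map
    sending a matched vertex to its mate is an involution only there. *)
Lemma even_fixfree_invol (T : finType) (W : {set T}) (s : T -> T) :
  {in W, forall x, [/\ s x \in W, s x != x & s (s x) = x]} -> ~~ odd #|W|.
Proof.
move: {2}#|W| (leqnn #|W|) => n; elim: n W => [|n IH] W leW sW.
  by move: leW; rewrite leqn0 => /eqP->.
have [->|/set0Pn[x xW]] := eqVneq W set0; first by rewrite cards0.
have [sxW sx ssx] := sW x xW.
have cW : #|W| = #|W :\ x :\ s x|.+2.
  by rewrite (cardsD1 x W) xW (cardsD1 (s x) (W :\ x)) !inE sx sxW.
rewrite cW /= negbK; apply: IH => [|y].
  by rewrite -ltnS ltnW // -cW.
rewrite !inE => /and3P[ysx yx yW]; have [syW sy ssy] := sW y yW.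
split=> //; rewrite syW andbT; apply/andP; split.
- by apply: contra yx => /eqP E; rewrite -ssy E ssx.
- by apply: contra ysx => /eqP E; rewrite -ssy E.
Qed.

(** * Gluing two proofs along unions of components *)

Section Glue.

Variables (G1 G2 : graph) (a1 : pred G1) (a2 : pred G2).
Hypothesis a1E : forall x y : G1, edge x y -> a1 x = a1 y.
Hypothesis a2E : forall x y : G2, edge x y -> a2 x = a2 y.

Definition glue_edge : rel (G1 + G2)%type := fun u v =>
  match u, v with
  | inl x, inl y => edge x y
  | inr x, inr y => edge x y
  | inl x, inr y => a1 x && a2 y
  | inr y, inl x => a1 x && a2 y
  end.

Lemma glue_edge_sym : symmetric glue_edge.
Proof. by move=> [x|x] [y|y] //=; rewrite edge_sym. Qed.

Lemma glue_edge_irr : irreflexive glue_edge.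
Proof. by move=> [x|x] /=; rewrite edge_irr. Qed.

(* With [a1] and [a2] unions of components, this is
   (a1 /\ a2) \/ (G1 \ a1) \/ (G2 \ a2). *)
Definition glue : graph := Graph glue_edge_sym glue_edge_irr.

(** [flag] is constant along edges, hence on the whole path. When it is true, non-adjacent vertices
    share a side; when it is false, adjacent ones do. Since a P4 and its complement are connected,
    the path lies in [G1] or in [G2]. *)
Lemma glue_p4_free :
  p4_free [set: G1] -> p4_free [set: G2] -> p4_free [set: glue].
Proof.
move=> P1 P2 v w x y _ _ _ _ vw wx xy vx vy wy.
pose flag (u : glue) := match u with inl x => a1 x | inr y => a2 y end.
pose side (u : glue) := match u with inl x => true | inr y => false end.
have flagE u t : edge u t -> flag u = flag t.
  case: u => u; case: t => t //=; try by [apply: a1E | apply: a2E];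
  by move=> /andP[-> ->].
have sideF u t : flag u = false -> edge u t -> side u = side t.
  by case: u => u; case: t => t //= ->; rewrite ?andbF.
have sideT u t : flag u -> flag t -> ~~ edge u t -> side u = side t.
  by case: u => u; case: t => t //= -> ->.
have fw := flagE _ _ vw; have fx := flagE _ _ wx; have fy := flagE _ _ xy.
have [sw sx sy] : [/\ side w = side v, side x = side v & side y = side v].
  case fv : (flag v).
    have sy : side y = side v by rewrite (sideT v y) // -fy -fx -fw.
    split=> //; last by rewrite (sideT v x) // -fx -fw.
    by rewrite -sy (sideT w y) // -?fy -?fx -fw.
  have sw : side w = side v by rewrite (sideF v w).
  have sx : side x = side v by rewrite -sw (sideF w x) // -fw.
  by split=> //; rewrite -sx (sideF x y) // -fx -fw.
move: v w x y sw sx sy vw wx xy vx vy wy {fw fx fy}.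
by move=> [v|v] [w|w] [x|x] [y|y] // _ _ _; [apply: P1 | apply: P2];
  rewrite inE.
Qed.

Variables (s1 : G1 -> G1) (s2 : G2 -> G2).
Hypothesis inv1 : involutive s1.
Hypothesis inv2 : involutive s2.
Hypothesis nice1 : forall W : {set G1},
  (forall w, w \in W -> s1 w \in W /\ s1 w != w) -> ~ induces_matching W.
Hypothesis nice2 : forall W : {set G2},
  (forall w, w \in W -> s2 w \in W /\ s2 w != w) -> ~ induces_matching W.

Definition glue_invol (u : glue) : glue :=
  match u with inl x => inl (s1 x) | inr y => inr (s2 y) end.

(* A matching containing an edge across [a1] and [a2] contains exactly one, and
   the rest of its trace on [G1] is perfectly matched; but that trace is a union
   of pairs, so it has even size. *)
Lemma glue_nice (W : {set glue}) :
  (forall w, w \in W -> glue_invol w \in W /\ glue_invol w != w) ->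
  ~ induces_matching W.
Proof.
move=> sW [/set0Pn[w0 w0W] mW].
pose W1 : {set G1} := [set x | (inl x : glue) \in W].
pose W2 : {set G2} := [set x | (inr x : glue) \in W].
have sW1 x : x \in W1 -> s1 x \in W1 /\ s1 x != x.
  by rewrite !inE => /sW.
have sW2 x : x \in W2 -> s2 x \in W2 /\ s2 x != x.
  by rewrite !inE => /sW.
have [/exists_inP[x xW1 /andP[ax /exists_inP[y yW2 ay]]]|nocross] :=
    boolP [exists x in W1, a1 x && [exists y in W2, a2 y]]; last first.
  have no x y : (inl x : glue) \in W -> (inr y : glue) \in W -> a1 x && a2 y = false.
    move=> xW yW; apply: contraNF nocross => /andP[ax ay].
    apply/exists_inP; exists x; rewrite ?inE // ax /=.
    by apply/exists_inP; exists y; rewrite ?inE.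
  case: w0 w0W => w0 w0W.
    apply: (nice1 sW1); split; first by apply/set0Pn; exists w0; rewrite inE.
    move=> x; rewrite inE => xW; have [[y|y] [[yW /= xy] uy]] := mW _ xW.
      exists y; split; first by rewrite inE.
      move=> z [zW xz]; rewrite inE in zW.
      by have [] := uy (inl z) (conj zW xz).
    by rewrite no in xy.
  apply: (nice2 sW2); split; first by apply/set0Pn; exists w0; rewrite inE.
  move=> x; rewrite inE => xW; have [[y|y] [[yW /= xy] uy]] := mW _ xW.
    by rewrite no in xy.
  exists y; split; first by rewrite inE.
  move=> z [zW xz]; rewrite inE in zW.
  by have [] := uy (inr z) (conj zW xz).
have ev1 : ~~ odd #|W1|.
  by apply: (@even_fixfree_invol _ _ s1) => z /sW1[? ?]; split.
have xW : (inl x : glue) \in W by rewrite inE in xW1.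
have yW : (inr y : glue) \in W by rewrite inE in yW2.
(* The mate of [z] inside [W1]; the mate of [x] is [y], so [x] has to be removed. *)
pose m z := odflt z [pick t in W1 | edge z t].
have mP z : z \in W1 :\ x -> [/\ m z \in W1 :\ x, m z != z & edge z (m z)].
  rewrite !inE => /andP[zx zW].
  (* Otherwise [y] would have two neighbours [x] and [z] in [W]. *)
  have az : a1 z = false.
    apply: contraNF zx => az; have [t [_ ut]] := mW _ yW.
    have E1 := ut (inl z) (conj zW _); rewrite /= az ay in E1.
    have E2 := ut (inl x) (conj xW _); rewrite /= ax ay in E2.
    by have [] := etrans (esym (E1 isT)) (E2 isT) => ->.
  have [[t|t] [[tW /= zt] _]] := mW _ zW; last by rewrite az in zt.
  rewrite /m; case: pickP => [t' /andP[t'W zt'] /=|/(_ t)]; last by rewrite inE tW zt.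
  rewrite inE in t'W; rewrite t'W andbT; split=> //.
    by apply: contraFN az => /eqP E; rewrite (a1E zt') E.
  by apply: contraTN zt' => /eqP->; rewrite edge_irr.
have : ~~ odd #|W1 :\ x|.
  apply: (@even_fixfree_invol _ _ m) => z zW; have [mzW mz zmz] := mP z zW.
  have [_ _ mmz] := mP _ mzW; have [mmzW _ _] := mP _ mzW; split=> //.
  move: zW mzW mmzW; rewrite !inE => /andP[_ zW] /andP[_ mzW] /andP[_ mmzW].
  have [t [_ ut]] := mW _ mzW.
  have E1 := ut (inl z) (conj zW _); rewrite /= edge_sym in E1.
  have E2 := ut (inl (m (m z))) (conj mmzW mmz).
  by have [] := etrans (esym (E1 zmz)) E2.
by move: ev1; rewrite (cardsD1 x W1) xW1 /= negbK => ->.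
Qed.

End Glue.

(** The components mapped into [A] are joined to those mapped into [B]; no edge of [G] leads from
    [A] or [B] to [R], so these preimages are unions of components. *)
Lemma provable_on_join (V : Type) (G : labelled_graph V) (A B R : {set G}) :
  {in A & B, forall x y, edge x y = true} ->
  {in A & R, forall x y, x != y /\ edge x y = false} ->
  {in B & R, forall x y, x != y /\ edge x y = false} ->
  provable_on (A :|: R) -> provable_on (B :|: R) ->
  provable_on (A :|: B :|: R).
Proof.
move=> AB AR BR [C1 [s1 [h1 pf1]]] [C2 [s2 [h2 pf2]]].
have RA x y : x \in R -> y \in A -> edge x y = false.
  by move=> xR yA; rewrite edge_sym; have [_] := AR y x yA xR.
have RB x y : x \in R -> y \in B -> edge x y = false.
  by move=> xR yB; rewrite edge_sym; have [_] := BR y x yB xR.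
pose a1 := [pred x | h1 x \in A]; pose a2 := [pred x | h2 x \in B].
have h1U x : h1 x \in A :|: R by have [_ _ []] := pf1.
have h2U x : h2 x \in B :|: R by have [_ _ []] := pf2.
have h1R x : ~~ a1 x -> h1 x \in R by have := h1U x; rewrite !inE => /orP[->|].
have h2R x : ~~ a2 x -> h2 x \in R by have := h2U x; rewrite !inE => /orP[->|].
(* A proof that misses [A] maps into [R] alone and serves unchanged; likewise for [B]. *)
case: (pickP a1) => [x1 ax1|none]; last first.
  exists C1, s1, h1; apply: proof_on_change pf1 => [v|v w].
    by rewrite inE h1R ?orbT // none.
  rewrite !inE negb_or => wU /andP[wA wR].
  by move: wU; rewrite (negbTE wA) (negbTE wR) orbF; apply: RB; rewrite h1R ?none.
case: (pickP a2) => [x2 ax2|none]; last first.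
  exists C2, s2, h2; apply: proof_on_change pf2 => [v|v w].
    by rewrite inE h2R ?orbT // none.
  rewrite !inE negb_or => wU /andP[wB wR].
  by move: wU; rewrite (negbTE wB) (negbTE wR) !orbF; apply: RA; rewrite h2R ?none.
move: pf1 pf2 => [[C10 P41 inv1 s1N] nice1 [hom1 _ skew1] ax_1].
move=> [[C20 P42 inv2 s2N] nice2 [hom2 _ skew2] ax_2].
have a1E x y : edge x y -> a1 x = a1 y.
  move=> xy; have hxy := hom1 _ _ xy; apply/idP/idP => aX; apply: contraTT hxy.
    by move=> /h1R yR; rewrite edge_sym RA.
  by move=> /h1R xR; rewrite RA.
have a2E x y : edge x y -> a2 x = a2 y.
  move=> xy; have hxy := hom2 _ _ xy; apply/idP/idP => aX; apply: contraTT hxy.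
    by move=> /h2R yR; rewrite edge_sym RB.
  by move=> /h2R xR; rewrite RB.
(* An [a2]-vertex whose image is not adjacent to [w]: any [a2]-vertex, or else a
   neighbour provided by the skew lifting property. *)
have avoid2 w : w \in B -> exists2 y, a2 y & ~~ edge (h2 y) w.
  move=> wB; have [x2w|] := boolP (edge (h2 x2) w); last by exists x2.
  have [|y x2y yw] := skew2 x2 w _ x2w; first by rewrite inE wB.
  by exists y; rewrite -?(a2E x2).
have avoid1 w : w \in A -> exists2 y, a1 y & ~~ edge (h1 y) w.
  move=> wA; have [x1w|] := boolP (edge (h1 x1) w); last by exists x1.
  have [|y x1y yw] := skew1 x1 w _ x1w; first by rewrite inE wA.
  by exists y; rewrite -?(a1E x1).
pose h (u : glue a1 a2) := match u with inl x => h1 x | inr y => h2 y end.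
exists (glue a1 a2), (@glue_invol _ _ a1 a2 s1 s2), h; split.
- split.
  + by apply/card_gt0P; exists (inl x1).
  + exact: glue_p4_free.
  + by move=> [x|x] /=; rewrite ?inv1 ?inv2.
  + by move=> [x|x] /=.
- exact: glue_nice.
- split.
  + move=> [x|x] [y|y] /=; [exact: hom1| | |exact: hom2].
      by move=> /andP[xA yB]; apply: AB.
    by move=> /andP[yA xB]; rewrite edge_sym; apply: AB.
  + move=> [x|x] /=; first by have := h1U x; rewrite !inE => /orP[]->; rewrite ?orbT.
    by have := h2U x; rewrite !inE => /orP[] ->; rewrite ?orbT.
  (* A [w] in the domain of the proof containing [x] lifts there; any other [w] lies across the
     join, and [avoid1] or [avoid2] supplies a vertex reached by a cross edge. *)
  + move=> [x|x] w wU /= xw.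
      have [wAR|wAR] := boolP (w \in A :|: R).
        by have [y xy yw] := skew1 x w wAR xw; exists (inl y).
      have wB : w \in B.
        move: wU wAR; rewrite !inE.
        by case: (w \in B) => //; rewrite orbF => ->.
      have xA : a1 x by apply: contraTT xw => /h1R xR; rewrite RB.
      by have [y ay yw] := avoid2 w wB; exists (inr y) => //; apply/andP.
    have [wBR|wBR] := boolP (w \in B :|: R).
      by have [y xy yw] := skew2 x w wBR xw; exists (inr y).
    have wA : w \in A.
      by move: wU wBR; rewrite !inE; case: (w \in A) => //= ->.
    have xB : a2 x by apply: contraTT xw => /h2R xR; rewrite RA.
    by have [y ay yw] := avoid1 w wA; exists (inl y) => //; apply/andP.
- by move=> [x|x] /=; [have := ax_1 x | have := ax_2 x].
Qed.

(* Distributing joins over the context [R] reduces provability to the maximal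
   stable sets, which play the role of the clauses of a conjunctive normal
   form. *)
Lemma provable_on_cotree (V : Type) (G : labelled_graph V) (X : {set G}) :
  cotree X -> forall R : {set G},
  {in X & R, forall x y, x != y /\ edge x y = false} ->
  (forall S : {set G}, max_homog false X S -> provable_on (S :|: R)) ->
  provable_on (X :|: R).
Proof.
elim=> {X} [x|b A B cA IA cB IB AB] R XR pv.
  apply: pv; split=> //; first by apply/set0Pn; exists x; rewrite inE.
  - by move=> y z; rewrite !inE => /eqP-> /eqP->; rewrite eqxx.
  - by move=> y ->.
have AR : {in A & R, forall x y, x != y /\ edge x y = false}.
  by move=> x y xA; apply: XR; rewrite inE xA.
have BR : {in B & R, forall x y, x != y /\ edge x y = false}.
  by move=> x y xB; apply: XR; rewrite inE xB orbT.
have BA : {in B & A, forall x y, x != y /\ edge x y = b}.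
  by move=> x y xB yA; rewrite eq_sym edge_sym; apply: AB.
case: b AB BA => AB BA.
  (* In a join, a stable set maximal in one part is maximal in the whole. *)
  apply: provable_on_join => //.
  - by move=> x y xA yB; have [] := AB x y xA yB.
  - apply: IA => // S [/set0Pn[s sS] /subsetP SA st dom]; apply: pv; split=> //.
    + by apply/set0Pn; exists s.
    + by apply/subsetP => x /SA xA; rewrite inE xA.
    + move=> x; rewrite inE => /orP[xA|xB] xS; first exact: dom.
      by exists s => //; have [] := BA x s xB (SA s sS).
  - apply: IB => // S [/set0Pn[s sS] /subsetP SB st dom]; apply: pv; split=> //.
    + by apply/set0Pn; exists s.
    + by apply/subsetP => x /SB xB; rewrite inE xB orbT.
    + move=> x; rewrite inE => /orP[xA|xB] xS; last exact: dom.
      by exists s => //; have [] := AB x s xA (SB s sS).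
(* In a union, first [A] is reduced in the context [B :|: R], then [B] in the context [S :|: R]; the
   resulting [S :|: S'] is maximal stable. *)
rewrite -setUA; apply: IA => [x y xA|S [S0 /subsetP SA st dom]].
  by rewrite inE => /orP[yB|yR]; [apply: AB | apply: AR].
rewrite setUCA; apply: IB => [x y xB|S' [_ /subsetP SB st' dom']].
  by rewrite inE => /orP[/SA yA|yR]; [apply: BA | apply: BR].
rewrite setUCA setUA; apply: pv; split.
- by rewrite setU_eq0 negb_and S0.
- apply/subsetP => x; rewrite !inE => /orP[/SA->//|/SB->]; by rewrite orbT.
- move=> x y; rewrite !inE => /orP[xS|xS] /orP[yS|yS] xy.
  + exact: st.
  + by have [] := AB x y (SA x xS) (SB y yS).
  + by have [] := BA x y (SB x xS) (SA y yS).
  + exact: st'.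
- move=> x; rewrite !inE negb_or => /orP[xA|xB] /andP[xS xS'].
    by have [y yS xy] := dom x xA xS; exists y; rewrite // inE yS.
  by have [y yS xy] := dom' x xB xS'; exists y; rewrite // inE yS orbT.
Qed.

(** Otherwise some valuation makes every label in [S] false, while truth of [phi] yields a maximal
    clique of true labels, and the two sets meet. *)
Lemma true_max_stable (V : Type) (phi : proposition V) (S : {set graph_of phi}) :
  is_true_prop phi -> max_homog false [set: graph_of phi] S ->
  (exists2 v, v \in S & label v = One) \/
  (exists v w, [/\ v \in S, w \in S & dual_literals (label v) (label w)]).
Proof.
move=> phiT mS; apply: NNPP => /not_or_and[no1 nod].
(* [p] is true exactly when its negation occurs in [S]; this is decided classically, as [V] is an
   arbitrary type. *)
pose f : valuation V := fun p =>
  if excluded_middle_informative (exists2 v, v \in S & label v = Neg p)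
  then true else false.
have lab v : v \in S -> eval_atom f (label v) = false.
  move=> vS; case E : (label v) => [p|p||] //=.
  - rewrite /f; case: excluded_middle_informative => // -[w wS wE].
    by case: nod; exists v, w; rewrite E wE.
  - by rewrite /f; case: excluded_middle_informative => // -[]; exists v.
  - by case: no1; exists v.
have [K [mK labK]] := eval_decides f phi; rewrite phiT in mK labK.
have [x xK xS] := max_clique_stable_meet (graph_of_cotree phi) mK mS.
by have := lab x xS; rewrite labK.
Qed.

Theorem theorem1 (V : Type) (phi : proposition V) :
  is_true_prop phi <-> has_combinatorial_proof phi.
Proof.
split; last exact: combinatorial_proof_sound.
move=> phiT; apply: provable_on_setT; rewrite -[X in provable_on X]setU0.
apply: provable_on_cotree; first exact: graph_of_cotree.
  by move=> x y _; rewrite inE.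
move=> S mS; rewrite setU0; apply: provable_on_stable.
  by move=> x y; apply: max_stableN mS.
exact: true_max_stable.
Qed.
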